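(* Let $R$ be a commutative ring with identity, let $A,B\in R$, and let $(w_n)_{n\ge0}$ be a sequence of elements of $R$ satisfying $w_{n+1}=Aw_n-Bw_{n-1}$ for all $n=1,2,3,\ldots$. Then for any integer $n>1$, $$\det[w_{|j-k+1|}]_{1\le j,k\le n}=(w_1^2-Aw_0w_1+Bw_0^2)\big((B+1)w_1-Aw_0\big)^{n-2}.$$
   Context: The convention $0^0=1$ is used. *)

(* Defs.v *)
From mathcomp Require Import all_boot all_order all_algebra.

(* Main.v *)
(** Let [M n] be the matrix of the theorem.  In the combination
    [col 0 - A * col 1 + B * col 2] of its columns, the recurrence kills every
    entry but the top one, which is [w 1 - A * w 0 + B * w 1].  Deleting the
    first row and column of [M n] leaves [M (n - 1)], so for [n >= 3] the
    determinant is multiplied by [(B + 1) * w 1 - A * w 0] at each step. *)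
Require Import Defs.
From mathcomp Require Import all_boot all_order all_algebra.
From mathcomp Require Import zify.
Import GRing.Theory.
Local Open Scope ring_scope.

Definition toeplitz_abs (R : comPzRingType) (w : nat -> R) (n : nat) : 'M[R]_n :=
  \matrix_(j < n, k < n) w (absz ((j : nat)%:Z - (k : nat)%:Z + 1)).

(* By Cramer, column [k] of [M] pairs with the cofactors of column [k0] to
   [\det M] or [0], so only the coefficient at [k0] survives. *)
Lemma det_col_comb (R : comPzRingType) (n : nat) (M : 'M[R]_n) (k0 k1 k2 : 'I_n)
    (a b : R) : k0 != k1 -> k0 != k2 ->
  \det M = \sum_i (M i k0 - a * M i k1 + b * M i k2) * cofactor M i k0.
Proof.
move=> n01 n02.
have adjE k : \sum_i M i k * cofactor M i k0 = (\det M) *+ (k0 == k).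
  have /matrixP/(_ k0 k) := mul_adj_mx M; rewrite !mxE => <-.
  by apply: eq_bigr => i _; rewrite mxE mulrC.
under eq_bigr => i _ do rewrite mulrDl mulrBl -!mulrA.
rewrite big_split sumrB -!mulr_sumr !adjE eqxx (negPf n01) (negPf n02) /=.
by rewrite !mulr0n !mulr0 subr0 addr0.
Qed.

(** An entry depends only on the difference of its indices, which a common shift by one
    preserves. *)
Lemma row'_col'_toeplitz_abs (R : comPzRingType) (w : nat -> R) (n : nat) :
  row' ord0 (col' ord0 (toeplitz_abs R w n.+1)) = toeplitz_abs R w n.
Proof.
apply/matrixP => i j; rewrite !mxE /= /bump !leq0n.
by congr (w _); lia.
Qed.

Lemma det_toeplitz_absS (R : comPzRingType) (A B : R) (w : nat -> R) (n : nat) :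
  (forall m : nat, (1 <= m)%N -> w m.+1 = A * w m - B * w m.-1) ->
  \det (toeplitz_abs R w n.+3) =
    ((B + 1) * w 1%N - A * w 0%N) * \det (toeplitz_abs R w n.+2).
Proof.
move=> hw.
rewrite (@det_col_comb _ _ _ 0 (inord 1) (inord 2) A B); last 2 first.
- by rewrite -val_eqE /= inordK.
- by rewrite -val_eqE /= inordK.
rewrite big_ord_recl big1 => [|i _]; rewrite !mxE /= !inordK //.
  rewrite addr0 /cofactor row'_col'_toeplitz_abs expr0 mul1r; congr (_ * _).
  by rewrite /= mulrDl mul1r addrAC [B * _ + _]addrC.
(* Row [i.+1] starts with [w i.+2], [w i.+1], [w i]: the recurrence at [i.+1] makes the combination
   vanish. *)
rewrite addn0 addn1 /bump leq0n add1n.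
have -> : absz (i.+1%:Z - 1%:Z + 1) = i.+1 by lia.
have -> : absz (i.+1%:Z - 2%:Z + 1) = i by lia.
by rewrite hw //= [A * _ - _]addrC addrK addNr mul0r.
Qed.

Theorem theorem1p2 (R : comPzRingType) (A B : R) (w : nat -> R)
    (hw : forall m : nat, (1 <= m)%N -> w m.+1 = A * w m - B * w m.-1)
    (n : nat) (hn : (1 < n)%N) :
  \det (\matrix_(j < n, k < n) w (absz ((j : nat)%:Z - (k : nat)%:Z + 1))) =
  (w 1%N ^+ 2 - A * w 0%N * w 1%N + B * w 0%N ^+ 2)
    * ((B + 1) * w 1%N - A * w 0%N) ^+ (n - 2).
Proof.
case: n hn => [|[|n]] // _; rewrite subn2 /= -/(toeplitz_abs R w n.+2).
elim: n => [|n IHn]; last by rewrite (det_toeplitz_absS _ A B) // IHn mulrCA -exprS.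
(* Size 2: the rows are [w 1, w 0] and [w 2, w 1]; substituting [w 2 = A * w 1 - B * w 0] in
   [w 1 ^+ 2 - w 0 * w 2] gives the first factor. *)
rewrite expr0 mulr1 (expand_det_row _ ord0) !big_ord_recl big_ord0 /cofactor !det_mx11.
rewrite !mxE -[LHS]/(w 1%N * (1 * w 1%N) + (w 0%N * (-1 * w 2%N) + 0)).
rewrite mul1r mulN1r addr0 mulrN (hw 1%N) //= mulrBr opprB addrA addrAC.
by rewrite !(mulrCA (w 0%N)) mulrA -!expr2.
Qed.
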